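(* $\mathsf{PTAB}(\mathsf{S4.3}_t)=\{L^\pm,L^+,L^-,L^\circ,L^\uparrow\}$ and $|\mathsf{PTAB}(\mathsf{S4.3}_t)|=5$.
   Context: Tense formulas use $\Box$ (future necessity) and a past possibility operator written here $\mathsf{P}$; $\mathsf{S4}_t=\mathsf{K}_t\oplus\{\Box p\to p,\Box p\to\Box\Box p\}$. $\mathsf{S4.3}_t$ is the tense logic of all reflexive transitive linear frames (equivalently $\mathsf{S4}_t$ extended by the bounds forth-width 1, back-width 1, z-degree 1). A logic is pretabular if it is not the logic of a finite frame but all its consistent proper extensions are; $\mathsf{PTAB}(L)$ is the set of pretabular logics extending $L$. Let $\mathfrak{C}_n=(n,\geq)$ (reflexive transitive chain of $n$ points) and $L^\uparrow=\bigcap_{n\geq1}\mathsf{Log}(\mathfrak{C}_n)$. For a frame $\mathfrak{F}=(X,R)$, a point $x$ and $\lambda\leq\omega$, $\mathfrak{F}^x_\lambda$ is obtained by replacing $x$ by a cluster of $1+\lambda$ points each having exactly the $R$-successors and $R$-predecessors of $x$. Put $\mathfrak{C}^\circ_\lambda=(\mathfrak{C}_1)^0_\lambda$ (a single cluster), $\mathfrak{C}^+_\lambda=(\mathfrak{C}_2)^1_\lambda$ (a cluster seeing one reflexive point above it), $\mathfrak{C}^-_\lambda=(\mathfrak{C}_2)^0_\lambda$ (one reflexive point seeing a cluster above it), $\mathfrak{C}^\pm_\lambda=(\mathfrak{C}_3)^1_\lambda$ (point, cluster, point, in a chain), and $L^t=\mathsf{Log}(\mathfrak{C}^t_\omega)$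 for $t\in\{\pm,+,-,\circ\}$. *)

(* Defs.v *)
(* MathComp, with classical sets from mathcomp.classical. *)
From mathcomp Require Import all_boot.
From mathcomp Require Import boolp classical_sets functions cardinality.

Set Implicit Arguments.
Unset Strict Implicit.
Unset Printing Implicit Defensive.

Local Open Scope classical_set_scope.

Inductive form : Type :=
| Var of nat
| Bot
| Imp of form & form
| Box of form    (* at all successors *)
| PDia of form.  (* at some predecessor *)

Fixpoint subst (s : nat -> form) (a : form) : form :=
  match a with
  | Var n => s n
  | Bot => Bot
  | Imp b c => Imp (subst s b) (subst s c)
  | Box b => Box (subst s b)
  | PDia b => PDia (subst s b)
  end.

(* Modalised formulas are treated as propositional atoms. *)
Fixpoint prop_eval (v : form -> bool) (a : form) : bool :=
  match a with
  | Bot => false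
  | Imp b c => prop_eval v b ==> prop_eval v c
  | Var _ | Box _ | PDia _ => v a
  end.

Definition tautology (a : form) : Prop := forall v, prop_eval v a.

(* Normal tense logics.  The residuation law [tl_adj] yields necessitation and
   distribution for both modalities, as well as the axioms p -> Box (PDia p)
   and PDia (Box p) -> p; the least such set is K_t. *)
Record tense_logic (L : set form) : Prop := TenseLogic {
  tl_taut : forall a, tautology a -> L a;
  tl_adj : forall a b, L (Imp (PDia a) b) <-> L (Imp a (Box b));
  tl_mp : forall a b, L (Imp a b) -> L a -> L b;
  tl_subst : forall s a, L a -> L (subst s a)
}.

Definition consistent (L : set form) : Prop := ~ L Bot.

(* The carrier may be empty.  The empty frame validates every formula, so the
   only effect is that the inconsistent logic counts as the logic of a finite
   frame, and hence is not pretabular. *)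
Record frame : Type := Frame {
  point :> Type;
  acc : point -> point -> Prop
}.

Fixpoint sat (F : frame) (V : nat -> set F) (x : F) (a : form) : Prop :=
  match a with
  | Var n => V n x
  | Bot => False
  | Imp b c => sat V x b -> sat V x c
  | Box b => forall y, acc x y -> sat V y b
  | PDia b => exists2 y, acc y x & sat V y b
  end.

Definition Log (F : frame) : set form :=
  [set a | forall (V : nat -> set F) (x : F), sat V x a].

Definition tabular (L : set form) : Prop :=
  exists2 F : frame, finite_set [set: F] & L = Log F.

Definition pretabular (L : set form) : Prop :=
  [/\ tense_logic L,
      ~ tabular L &
      forall L', tense_logic L' -> L `<` L' -> consistent L' -> tabular L'].

Definition PTAB (L : set form) : set (set form) :=
  [set L' | L `<=` L' /\ pretabular L'].

Definition linear_preorder (F : frame) : Prop :=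
  [/\ forall x : F, acc x x,
      forall x y z : F, acc x y -> acc y z -> acc x z &
      forall x y : F, acc x y \/ acc y x].

Definition S43t : set form :=
  [set a | forall F : frame, linear_preorder F -> Log F a].

(* Points are 0, ..., n-1 and x sees y iff x >= y: the root is n-1, the top 0. *)
Definition chain (n : nat) : frame :=
  @Frame 'I_n (fun x y => (y <= x)%N).

(* F^x_lambda for a cardinal lambda = |I|: the point x is kept as [inl x] and
   the points [inr i] are added, so x becomes 1 + |I| points, all related to
   exactly what x is related to.  They form a cluster when x is reflexive. *)
Definition blowup (F : frame) (x : F) (I : Type) : frame :=
  let orig (u : F + I) := if u is inl y then y else x in
  @Frame (F + I)%type (fun u v => acc (orig u) (orig v)).

Definition C_circ (I : Type) : frame :=
  @blowup (chain 1) (Ordinal (isT : 0 < 1)%N) I.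
Definition C_plus (I : Type) : frame :=
  @blowup (chain 2) (Ordinal (isT : 1 < 2)%N) I.
Definition C_minus (I : Type) : frame :=
  @blowup (chain 2) (Ordinal (isT : 0 < 2)%N) I.
Definition C_pm (I : Type) : frame :=
  @blowup (chain 3) (Ordinal (isT : 1 < 3)%N) I.

Definition L_circ : set form := Log (C_circ nat).
Definition L_plus : set form := Log (C_plus nat).
Definition L_minus : set form := Log (C_minus nat).
Definition L_pm : set form := Log (C_pm nat).

Definition L_up : set form := \bigcap_(n in [set n | (1 <= n)%N]) Log (chain n).

(* Main.v *)
(* A tense logic L containing S43t is sound for the definable sets of linear
   models refuting its non-theorems.  If the number of pieces of definable
   partitions is bounded, L is the logic of a finite disjoint union of finite
   quotients.  Otherwise cut a model into a maximal chain of layers by definable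
   upsets: either the number of layers is unbounded and L is contained in
   L_up, or the layers number at most m and some layer has many definable
   pieces.  By maximality every definable set meeting a layer is cofinal and
   coinitial in it, so that layer collapses to a large cluster, and all points
   above (below) it to a single reflexive point; hence L is contained in one of
   the four cluster logics.  It remains to see that the five logics are
   nontabular and pairwise incomparable, which is witnessed by the Grzegorczyk
   axiom, bounded depth and the two McKinsey axioms. *)
Require Import Defs.
From mathcomp Require Import all_boot.
From mathcomp Require Import boolp classical_sets functions cardinality.

Set Implicit Arguments.
Unset Strict Implicit.
Unset Printing Implicit Defensive.

Local Open Scope classical_set_scope.
Local Open Scope card_scope.

(** * Derived connectives, Kripke soundness and logics of frames *)

Definition Neg a := Imp a Bot.
Definition And a b := Neg (Imp a (Neg b)).
Definition Or a b := Imp (Neg a) b.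
Definition Dia a := Neg (Box (Neg a)).
Definition PBox a := Neg (PDia (Neg a)).

Section Satisfaction.
Variables (F : frame) (V : nat -> set F).
Implicit Types (x : F) (a b : form).

Lemma sat_Imp x a b : sat V x (Imp a b) <-> (sat V x a -> sat V x b).
Proof. by []. Qed.

Lemma sat_Neg x a : sat V x (Neg a) <-> ~ sat V x a.
Proof. by []. Qed.

Lemma sat_Box x a : sat V x (Box a) <-> forall y, acc x y -> sat V y a.
Proof. by []. Qed.

Lemma sat_PDia x a : sat V x (PDia a) <-> exists2 y, acc y x & sat V y a.
Proof. by []. Qed.

Lemma sat_And x a b : sat V x (And a b) <-> sat V x a /\ sat V x b.
Proof.
split=> [h|[ha hb] /(_ ha hb)//].
by split; apply: contrapT => n; apply: h => // ? /n.
Qed.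

Lemma sat_Or x a b : sat V x (Or a b) <-> sat V x a \/ sat V x b.
Proof.
split=> [h|[ha /(_ ha)//|hb _ //]].
by have [ha|na] := EM (sat V x a); [left|right; apply: h].
Qed.

Lemma sat_Dia x a : sat V x (Dia a) <-> exists2 y, acc x y & sat V y a.
Proof.
split=> [h|[y xy ya] /(_ y xy ya)//].
by apply: contrapT => n; apply: h => y xy ya; apply: n; exists y.
Qed.

Lemma sat_PBox x a : sat V x (PBox a) <-> forall y, acc y x -> sat V y a.
Proof.
split=> [h y yx|h [y yx /(_ (h _ yx))//]].
by apply: contrapT => n; apply: h; exists y.
Qed.

Lemma sat_tautology x a : tautology a -> sat V x a.
Proof.
(* The propositional valuation reads off truth at [x] of every formula, so modalised formulas become
   atoms with their actual value. *)
have evalE b : prop_eval (fun c => `[< sat V x c >]) b <-> sat V x b.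
  elim: b => [n||b IHb c IHc|b _|b _] /=; try exact: (iff_sym (rwP (asboolP _))).
    by split.
  split=> [/implyP h /IHb /h /IHc//|h].
  by apply/implyP => /IHb /h /IHc.
by move=> /(_ (fun c => `[< sat V x c >])) /evalE.
Qed.

Lemma sat_subst (s : nat -> form) x a :
  sat V x (subst s a) <-> sat (fun n y => sat V y (s n)) x a.
Proof.
elim: a x => [n||b IHb c IHc|b IHb|b IHb] x //=.
- by rewrite (propext (IHb x)) (propext (IHc x)).
- by split=> h y /h /IHb.
- by split=> -[y yx /IHb yb]; exists y.
Qed.

End Satisfaction.

Lemma Log_tense (F : frame) : tense_logic (Log F).
Proof.
split.
- by move=> a ta V x; apply: sat_tautology.
- move=> a b; split=> h V x.
    by move=> xa y xy; apply: h; exists x.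
  by case=> y yx ya; apply: (h V y).
- by move=> a b hab ha V x; apply: (hab V x (ha V x)).
- by move=> s a ha V x; apply/sat_subst.
Qed.

Lemma bigcap_tense I (D : set I) (L : I -> set form) :
  (forall i, tense_logic (L i)) -> tense_logic (\bigcap_(i in D) L i).
Proof.
move=> tL; split.
- by move=> a ta i _; apply: (tl_taut (tL i)).
- by move=> a b; split=> h i /h /(tl_adj (tL i)).
- by move=> a b hab ha i Di; apply: (tl_mp (tL i) (hab i Di)) (ha i Di).
- by move=> s a ha i /ha; apply: (tl_subst (tL i)).
Qed.

(** * Canonical models *)

Section CanonicalModel.
Variables (L : set form) (tL : tense_logic L) (S4L : S43t `<=` L).

(** Local consequence: closure under necessitation or substitution is not demanded. *)
Definition theory (T : set form) :=
  L `<=` T /\ forall a b, T (Imp a b) -> T a -> T b.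

Definition maxcons (T : set form) :=
  [/\ theory T, ~ T Bot & forall a, T a \/ T (Neg a)].

Lemma theory_taut T a : theory T -> tautology a -> T a.
Proof. by case=> LT _ ta; apply: LT; apply: tl_taut ta. Qed.

(** Lindenbaum's lemma. A theory maximal among those omitting [a] decides every [b]: if it omitted
    both [b] and [Neg b], both would imply [a] in it, hence [a] would belong to it. *)
Lemma extend_theory T a :
  theory T -> ~ T a -> exists2 U, maxcons U & T `<=` U /\ ~ U a.
Proof.
move=> [LT mpT] nTa.
(* Zorn's lemma also tests the empty chain, whose union is empty; adding [T] inside the property
   makes that case hold. *)
pose P X := theory (T `|` X) /\ ~ (T `|` X) a.
have [|X [[[LX mpX] nXa] maxX]] := @Zorn_bigcup _ P.
  move=> C CP totC; split; last first.
    by case=> [//|[X CX Xa]]; case: (CP X CX) => _; apply; right.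
  split=> [b /LT|b c]; first by left.
  case=> [Tbc|[X CX Xbc]] [Tb|[Y CY Yb]].
  - by left; apply: mpT Tbc Tb.
  - have [[_ mpY] _] := CP Y CY.
    by case: (mpY b c (or_introl Tbc) (or_intror Yb)); [left|right; exists Y].
  - have [[_ mpX] _] := CP X CX.
    by case: (mpX b c (or_intror Xbc) (or_introl Tb)); [left|right; exists X].
  - have [[_ mpX] _] := CP X CX; have [[_ mpY] _] := CP Y CY.
    have [XY|YX] := totC X Y CX CY.
      case: (mpY b c (or_intror (XY _ Xbc)) (or_intror Yb)) => ?; first by left.
      by right; exists Y.
    case: (mpX b c (or_intror Xbc) (or_intror (YX _ Yb))) => ?; first by left.
    by right; exists X.
set U := T `|` X in LX mpX nXa.
have thU : theory U by [].
have impa b : ~ U b -> U (Imp b a).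
  move=> nUb; apply: contrapT => nUba.
  (* [Y] is the deductive closure of [U] with [b]; if it omitted [a], it would contradict
     maximality. *)
  pose Y := [set c | U (Imp b c)].
  have UY : U `<=` Y.
    move=> c Uc; apply: mpX Uc; apply: theory_taut => // v /=.
    by case: (prop_eval v b); case: (prop_eval v c).
  have Yb : U (Imp b b) by apply: theory_taut => // v /=; case: (prop_eval v b).
  have TY : T `|` Y = Y by apply/setUidPr => c Tc; apply: UY; left.
  apply: (maxX Y).
    split; first by move=> c Xc; apply: UY; right.
    by move=> /(_ b Yb) Xb; apply: nUb; right.
  rewrite /P TY; split; last exact: nUba.
  split=> [c Lc|c d Ycd Yc]; first exact/UY/LX.
  have taut3 : U (Imp (Imp b (Imp c d)) (Imp (Imp b c) (Imp b d))).
    apply: theory_taut => // v /=.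
    by case: (prop_eval v b); case: (prop_eval v c); case: (prop_eval v d).
  exact: mpX (mpX _ _ taut3 Ycd) Yc.
exists U; last by split=> // b Tb; left.
split=> // [Ub|b].
  by apply: nXa; apply: mpX Ub; apply: theory_taut.
apply: contrapT => /not_orP[/impa Uba /impa Unba]; apply: nXa.
have taut3 : U (Imp (Imp b a) (Imp (Imp (Neg b) a) a)).
  apply: theory_taut => // v /=.
  by case: (prop_eval v b); case: (prop_eval v a).
exact: mpX (mpX _ _ taut3 Uba) Unba.
Qed.

(** Every axiom required below can thus be checked semantically on linear preorders instead of being
    derived. *)
Lemma maxcons_ax T a : maxcons T -> S43t a -> T a.
Proof. by case=> -[LT _] _ _ /S4L /LT. Qed.

Lemma maxcons_Imp T a b : maxcons T -> T (Imp a b) <-> (T a -> T b).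
Proof.
case=> thT nB total; split; first by case: thT => _ mp; apply: mp.
case: (thT) => _ mp h; have [/h Tb|Tna] := total a.
  apply: (mp) Tb; apply: theory_taut => // v /=.
  by case: (prop_eval v a); case: (prop_eval v b).
apply: (mp) Tna; apply: theory_taut => // v /=.
by case: (prop_eval v a); case: (prop_eval v b).
Qed.

Lemma maxcons_Neg T a : maxcons T -> T (Neg a) <-> ~ T a.
Proof.
move=> mT; rewrite (propext (maxcons_Imp a Bot mT)).
by split=> h /h //; case: mT.
Qed.

Lemma maxcons_Or T a b : maxcons T -> T (Or a b) <-> T a \/ T b.
Proof.
move=> mT; rewrite (propext (maxcons_Imp _ _ mT)) (propext (maxcons_Neg _ mT)).
by split=> [|[]//]; have [?|?] := EM (T a); [left|right; auto].
Qed.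

(** From [a] follows [Imp (PDia (Neg Bot)) a], whose transpose under residuation has a tautology as
    antecedent. *)
Lemma Box_nec a : L a -> L (Box a).
Proof.
move=> La; have taut1 : tautology (Imp a (Imp (PDia (Neg Bot)) a)).
  by move=> v /=; case: (prop_eval v a); rewrite ?implybT.
have /(tl_adj tL) h := tl_mp tL (tl_taut tL taut1) La.
by apply: (tl_mp tL h); apply: (tl_taut tL).
Qed.

Lemma PBox_nec a : L a -> L (PBox a).
Proof.
move=> La; apply/(tl_adj tL).
apply: (tl_mp tL _ La); apply: (tl_taut tL) => v /=.
by case: (prop_eval v a).
Qed.

Definition canR (T U : set form) := forall a, T (Box a) -> U a.

Lemma canR_PBox T U a : maxcons T -> maxcons U ->
  canR T U -> U (PBox a) -> T a.
Proof.
move=> mT mU TU Ua; apply: contrapT => /(maxcons_Neg _ mT) Tna.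
move: Ua; rewrite (propext (maxcons_Neg _ mU)); apply; apply: TU.
have : T (Imp (Neg a) (Box (PDia (Neg a)))).
  by apply: maxcons_ax => // F _ V x na y xy; exists x.
by move=> /(maxcons_Imp _ _ mT); apply.
Qed.

Lemma canR_exists T a : maxcons T -> ~ T (Box a) ->
  exists U, [/\ maxcons U, canR T U & ~ U a].
Proof.
move=> mT nTa; have [[LT mp] _ _] := mT.
have [|//|U mU [TU nUa]] := @extend_theory [set b | T (Box b)] a; last by exists U.
split=> [b /Box_nec /LT //|b c Tbc]; apply: (mp); apply: (mp) Tbc.
apply: maxcons_ax => // F _ V x /= hbc hb y xy.
exact: hbc _ xy (hb _ xy).
Qed.

Lemma canR_PDia T U a : maxcons T -> maxcons U ->
  canR T U -> T a -> U (PDia a).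
Proof.
move=> mT mU TU Ta; apply: TU.
have : T (Imp a (Box (PDia a))).
  by apply: maxcons_ax => // F _ V x xa y xy; exists x.
by move=> /(maxcons_Imp _ _ mT); apply.
Qed.

(** The formulas [b] with [PBox b] in [T] form a theory omitting [Neg a]. Any maximal extension sees
    [T], because [Neg b] in [T] puts [Neg (Box b)] in that theory. *)
Lemma canR_past_exists T a : maxcons T -> T (PDia a) ->
  exists U, [/\ maxcons U, canR U T & U a].
Proof.
move=> mT Ta; have [[LT mp] nB _] := mT.
have [||U mU [TU nUa]] := @extend_theory [set b | T (PBox b)] (Neg a).
- split=> [b /PBox_nec /LT //|b c Tbc]; apply: (mp); apply: (mp) Tbc.
  apply: maxcons_ax => // F _ V x.
  apply/sat_Imp => /sat_PBox hbc; apply/sat_Imp => /sat_PBox hb.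
  by apply/sat_PBox => y yx; apply: hbc _ yx (hb _ yx).
- move=> /(maxcons_Neg _ mT); apply.
  have : T (Imp (PDia a) (PDia (Neg (Neg a)))).
    by apply: maxcons_ax => // F _ V x [y yx ya]; exists y => // /(_ ya).
  by move=> /(maxcons_Imp _ _ mT); apply.
exists U; split=> //; last first.
  by apply: contrapT => /(maxcons_Neg _ mU).
move=> b Ub; apply: contrapT => /(maxcons_Neg _ mT) Tnb.
have : T (Imp (Neg b) (PBox (Neg (Box b)))).
  apply: maxcons_ax => // F _ V x; apply/sat_Imp => nb; apply/sat_PBox => y yx yb.
  exact/nb/yb.
move=> /(maxcons_Imp _ _ mT) /(_ Tnb) /TU.
by move=> /(maxcons_Neg _ mU); apply.
Qed.

Lemma canR_refl T : maxcons T -> canR T T.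
Proof.
move=> mT a Ta; have : T (Imp (Box a) a).
  by apply: maxcons_ax => // F [rF _ _] V x; apply; apply: rF.
by move=> /(maxcons_Imp _ _ mT); apply.
Qed.

Lemma canR_trans T U W : maxcons T -> canR T U -> canR U W -> canR T W.
Proof.
move=> mT TU UW a Ta; apply/UW/TU.
have : T (Imp (Box a) (Box (Box a))).
  apply: maxcons_ax => // F [_ tF _] V x /= h y xy z yz.
  by apply: h; apply: tF yz.
by move=> /(maxcons_Imp _ _ mT); apply.
Qed.

(** Witnesses [a], [b] of incomparability would contradict the axiom of no forward branching, [Or
    (Box (Imp (Box a) b)) (Box (Imp (Box b) a))]; the backward case uses its [PBox] analogue. *)
Lemma canR_fwd T U W : maxcons T -> maxcons U -> maxcons W ->
  canR T U -> canR T W -> canR U W \/ canR W U.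
Proof.
move=> mT mU mW TU TW; apply: contrapT => /not_orP[].
move=> /existsNP[a /not_implyP[Ua nWa]] /existsNP[b /not_implyP[Wb nUb]].
have : T (Or (Box (Imp (Box a) b)) (Box (Imp (Box b) a))).
  apply: maxcons_ax => // F [_ _ lF] V x; apply/sat_Or.
  apply: contrapT => /not_orP[].
  move=> /existsNP[y /not_implyP[xy /not_implyP[ya nyb]]].
  move=> /existsNP[z /not_implyP[xz /not_implyP[zb nza]]].
  by have [/ya|/zb] := lF y z.
move=> /(maxcons_Or _ _ mT)[/TU|/TW].
  by move=> /(maxcons_Imp _ _ mU) /(_ Ua).
by move=> /(maxcons_Imp _ _ mW) /(_ Wb).
Qed.

Lemma canR_bwd T U W : maxcons T -> maxcons U -> maxcons W ->
  canR U T -> canR W T -> canR U W \/ canR W U.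
Proof.
move=> mT mU mW UT WT; apply: contrapT => /not_orP[].
move=> /existsNP[a /not_implyP[Ua nWa]] /existsNP[b /not_implyP[Wb nUb]].
have : T (Or (PBox (Imp (Box a) b)) (PBox (Imp (Box b) a))).
  apply: maxcons_ax => // F [_ _ lF] V x; apply/sat_Or.
  rewrite !(propext (sat_PBox _ _ _)).
  apply: contrapT => /not_orP[].
  move=> /existsNP[y /not_implyP[xy /not_implyP[ya nyb]]].
  move=> /existsNP[z /not_implyP[xz /not_implyP[zb nza]]].
  by have [/ya|/zb] := lF y z.
move=> /(maxcons_Or _ _ mT)[|].
  by move=> /(canR_PBox mU mT UT) /(maxcons_Imp _ _ mU) /(_ Ua).
by move=> /(canR_PBox mW mT WT) /(maxcons_Imp _ _ mW) /(_ Wb).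
Qed.

(** One step from [T] suffices: by transitivity and the absence of branching, this set is closed
    under canonical successors and predecessors. *)
Definition component (T : set form) : frame :=
  @Frame {U | maxcons U /\ (canR T U \/ canR U T)}
         (fun U W => canR (sval U) (sval W)).

Lemma component_linear T : maxcons T -> linear_preorder (component T).
Proof.
move=> mT; split.
- by move=> [U [mU ?]]; apply: canR_refl.
- by move=> [U [mU ?]] [W [mW ?]] [X [mX ?]]; apply: canR_trans.
- move=> [U [mU [TU|UT]]] [W [mW [TW|WT]]] /=.
  + exact: (canR_fwd mT).
  + by right; apply: canR_trans WT TU.
  + by left; apply: canR_trans UT TW.
  + exact: (canR_bwd mT).
Qed.

Lemma component_sat T (U : component T) a : maxcons T ->
  sat (fun n (W : component T) => sval W (Var n)) U a <-> sval U a.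
Proof.
move=> mT; elim: a U => [n||a IHa b IHb|a IHa|a IHa] [U [mU cU]] //=.
- by split=> // UB; case: mU.
- rewrite (propext (maxcons_Imp a b mU)).
  by rewrite (propext (IHa _)) (propext (IHb _)).
- split=> [h|Ua W UW]; last by apply/IHa/UW.
  apply: contrapT => /(canR_exists mU)[W [mW UW nWa]]; apply: nWa.
  have cW : canR T W \/ canR W T.
    case: cU => [TU|UT]; first by left; apply: canR_trans TU UW.
    exact: (canR_fwd mU).
  pose W' : component T := exist _ W (conj mW cW).
  by apply/(IHa W')/h.
- split=> [[[W [mW cW]] /= WU /IHa]|]; first exact: canR_PDia.
  move=> /(canR_past_exists mU)[W [mW WU Wa]].
  have cW : canR T W \/ canR W T.
    case: cU => [TU|UT]; last by right; apply: canR_trans WU UT.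
    exact: (canR_bwd mU).
  pose W' : component T := exist _ W (conj mW cW).
  by exists W' => //; apply/(IHa W').
Qed.

End CanonicalModel.

Definition models (F : frame) (V : nat -> set F) (L : set form) :=
  forall a, L a -> forall x, sat V x a.

(* [F] with the sets definable in [V] is a general frame for [L]; passing to a
   connected component of the canonical model makes [F] linear, also for the
   Kripke incomplete [L]. *)
Lemma linear_model L a : tense_logic L -> S43t `<=` L -> ~ L a ->
  exists (F : frame) (V : nat -> set F),
    [/\ linear_preorder F, models V L & exists x, ~ sat V x a].
Proof.
move=> tL SL nLa.
have [|T mT [LT nTa]] := extend_theory tL _ nLa.
  by split=> // b c; apply: tl_mp.
exists (component L T), (fun n (W : component L T) => sval W (Var n)); split.
- exact: component_linear.
- move=> b Lb [U [mU cU]]; apply/component_sat => //=.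
  by have [[+ _] _ _] := mU; apply.
- have cT : canR T T \/ canR T T by left; apply: canR_refl mT.
  by exists (exist _ T (conj mT cT)); move/component_sat => /(_ tL SL mT).
Qed.

(** * Bisimulations and bounded morphisms *)

Fixpoint occurs (n : nat) (a : form) : Prop :=
  match a with
  | Var m => n = m
  | Bot => False
  | Imp b c => occurs n b \/ occurs n c
  | Box b | PDia b => occurs n b
  end.

(** Agreement is demanded only on the variables of [a], which leaves finitely many conditions when a
    cluster is cut down to finite size. *)
Lemma bisimulation (F G : frame) (V : nat -> set F) (U : nat -> set G)
    (Z : F -> G -> Prop) (a : form) :
  (forall x y n, Z x y -> occurs n a -> (V n x <-> U n y)) ->
  (forall x y x', Z x y -> acc x x' -> exists2 y', acc y y' & Z x' y') ->
  (forall x y y', Z x y -> acc y y' -> exists2 x', acc x x' & Z x' y') ->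
  (forall x y x', Z x y -> acc x' x -> exists2 y', acc y' y & Z x' y') ->
  (forall x y y', Z x y -> acc y' y -> exists2 x', acc x' x & Z x' y') ->
  forall x y, Z x y -> (sat V x a <-> sat U y a).
Proof.
move=> ZV Zf Zb Zpf Zpb.
elim: a ZV => [n||b IHb c IHc|b IHb|b IHb] ZV x y xy //=.
- exact: ZV.
- have Eb := IHb (fun x y n xy nb => ZV x y n xy (or_introl nb)) _ _ xy.
  have Ec := IHc (fun x y n xy nc => ZV x y n xy (or_intror nc)) _ _ xy.
  by rewrite (propext Eb) (propext Ec).
- split=> h z.
    by move=> /(Zb _ _ _ xy)[x' xx' x'z]; apply/(IHb ZV _ _ x'z)/h.
  by move=> /(Zf _ _ _ xy)[y' yy' zy']; apply/(IHb ZV _ _ zy')/h.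
- split=> -[z].
    move=> /(Zpf _ _ _ xy)[y' yy' zy'] zb.
    by exists y' => //; apply/(IHb ZV _ _ zy').
  move=> /(Zpb _ _ _ xy)[x' xx' x'z] zb.
  by exists x' => //; apply/(IHb ZV _ _ x'z).
Qed.

Definition bounded_morphism (F G : frame) (g : F -> G) :=
  [/\ forall x y, acc x y -> acc (g x) (g y),
      forall x u, acc (g x) u -> exists2 y, acc x y & g y = u &
      forall x u, acc u (g x) -> exists2 y, acc y x & g y = u].

Lemma bounded_morphism_sat (F G : frame) (g : F -> G) V U x a :
  bounded_morphism g -> (forall n y, V n y <-> U n (g y)) ->
  sat V x a <-> sat U (g x) a.
Proof.
move=> [gm gf gp] VU; apply: (@bisimulation _ _ _ _ (fun x u => g x = u)) => //.
- by move=> y _ n <- _.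
- by move=> y _ y' <- yy'; exists (g y') => //; apply: gm.
- by move=> y _ u <- /gf.
- by move=> y _ y' <- yy'; exists (g y') => //; apply: gm.
- by move=> y _ u <- /gp.
Qed.

(** * Definable sets and definable maps of a model *)

Section Definable.
Variables (F : frame) (V : nat -> set F).

Definition definable (P : set F) := exists a, forall x, sat V x a <-> P x.

Lemma definableC P : definable P -> definable (~` P).
Proof.
move=> [a Pa]; exists (Neg a) => x /=.
by rewrite (propext (Pa x)).
Qed.

Lemma definableI P Q : definable P -> definable Q -> definable (P `&` Q).
Proof.
move=> [a Pa] [b Qb]; exists (And a b) => x.
by rewrite (propext (sat_And V x a b)) (propext (Pa x)) (propext (Qb x)).
Qed.

Lemma definableU P Q : definable P -> definable Q -> definable (P `|` Q).
Proof.
move=> dP dQ; rewrite -[_ `|` _]setCK setCU.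
by apply/definableC/definableI; apply: definableC.
Qed.

Lemma definable_pred P : definable P -> definable [set x | exists2 y, acc x y & P y].
Proof.
move=> [a Pa]; exists (Dia a) => x; rewrite (propext (sat_Dia V x a)).
by split=> -[y xy /Pa ?]; exists y.
Qed.

Lemma definable_succ P : definable P -> definable [set x | exists2 y, acc y x & P y].
Proof.
by move=> [a Pa]; exists (PDia a) => x; split=> -[y xy /Pa ?]; exists y.
Qed.

Lemma definable_exists (T : finType) (Q : T -> set F) :
  (forall t, definable (Q t)) -> definable [set x | exists t, Q t x].
Proof.
move=> dQ.
have dE (s : seq T) : definable [set x | exists2 t, t \in s & Q t x].
  elim: s => [|t s [a IHs]]; first by exists Bot => x; split=> // -[].
  have [b Qb] := dQ t.
  have [c Qc] : definable (Q t `|` [set x | exists2 t, t \in s & Q t x]).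
    by apply: definableU; [exists b|exists a].
  exists c => x; rewrite (propext (Qc x)); split=> [[Qx|[t' t's Qx]]|[t']].
  - by exists t; rewrite ?mem_head.
  - by exists t' => //; rewrite inE t's orbT.
  - by rewrite inE => /orP[/eqP ->|t's] Qx; [left|right; exists t'].
have [a Qa] := dE (enum T); exists a => x; rewrite (propext (Qa x)).
by split=> [[t _ Qx]|[t Qx]]; exists t => //; rewrite mem_enum.
Qed.

(** Every valuation on the target pulls back to definable sets, as for a map of general frames. *)
Definition definable_map (T : Type) (f : F -> T) :=
  forall P : set T, definable (f @^-1` P).

Lemma definable_map_comp T T' (f : F -> T) (g : T -> T') :
  definable_map f -> definable_map (g \o f).
Proof. by move=> df P; apply: (df (g @^-1` P)). Qed.

Lemma definable_map_fin (T : finType) (f : F -> T) :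
  (forall t, definable (f @^-1` [set t])) -> definable_map f.
Proof.
move=> df P.
have [|a Pa] := @definable_exists T (fun t => [set x | f x = t /\ P t]).
  move=> t; have [Pt|nPt] := EM (P t).
    have [a fa] := df t; exists a => x; rewrite (propext (fa x)).
    by split=> [|[]].
  by exists Bot => x; split=> // -[].
exists a => x; rewrite (propext (Pa x)).
by split=> [[_ [<-]]//|Px]; exists (f x).
Qed.

Lemma definable_map_pair (T T' : finType) (f : F -> T) (g : F -> T') :
  definable_map f -> definable_map g -> definable_map (fun x => (f x, g x)).
Proof.
move=> df dg; apply: definable_map_fin => -[t t'].
have [a fa] := definableI (df [set t]) (dg [set t']).
exists a => x; rewrite (propext (fa x)).
by split=> [[/= -> ->]|[<- <-]].
Qed.

Lemma definable_map_bool P : definable P -> definable_map (fun x => `[< P x >]).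
Proof.
move=> [a Pa]; apply: definable_map_fin => -[].
  exists a => x; rewrite (propext (Pa x)).
  by split=> [/asboolP|/asboolP].
exists (Neg a) => x /=; rewrite (propext (Pa x)); split=> [/asboolPn/negbTE //|].
by move=> /negbT/asboolPn.
Qed.

(** Given a valuation on [G], substitute for each variable a formula defining its preimage. [L]
    contains the resulting instance, so it holds in the model, and the morphism carries its truth to
    [G]. *)
Lemma definable_morphism_Log (G : frame) (g : F -> G) (L : set form) :
  tense_logic L -> models V L -> bounded_morphism g ->
  (forall u, exists x, g x = u) -> definable_map g -> L `<=` Log G.
Proof.
move=> tL mL bg sg dg a La U u; have [x <-] := sg u.
have [s sP] := choice (fun n => dg (U n)).
have := mL _ (tl_subst tL s La) x.
rewrite (propext (sat_subst _ _ _ _)) => /bounded_morphism_sat; apply=> //.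
Qed.

End Definable.

(** * Boundedly many definable pieces: finite quotients and tabularity *)

Lemma last_before (P : nat -> Prop) N :
  P 1 -> ~ P N.+1 -> exists2 m, 0 < m <= N & P m /\ ~ P m.+1.
Proof.
move=> P1; elim: N => [/(_ P1)//|N IHN nP].
have [PN|/IHN[m /andP[m0 mN] Pm]] := EM (P N.+1); first by exists N.+1; rewrite ?leqnn.
by exists m => //; rewrite m0 leqW.
Qed.

Definition definable_onto (F : frame) (V : nat -> set F) (T : Type) :=
  exists2 c : F -> T, definable_map V c & forall t, exists x, c x = t.

(** Take a definable partition with the largest number [m] of pieces. A definable set splitting a
    piece would give [m.+1] pieces, so definable sets are unions of pieces; the quotient is then a
    bounded morphism through which [V] factors. *)
Lemma finite_quotient (F : frame) (V : nat -> set F) (L : set form) N (x0 : F) :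
  tense_logic L -> models V L -> ~ definable_onto V 'I_N.+1 ->
  exists (m : nat) (r : 'I_m -> 'I_m -> Prop), [/\ m <= N, L `<=` Log (Frame r) &
    forall a, Log (Frame r) a -> forall x, sat V x a].
Proof.
move=> tL mL nV.
have P1 : definable_onto V 'I_1.
  exists (fun=> ord0) => [P|t]; last by exists x0; rewrite [t]ord1.
  have [P0|nP0] := EM (P ord0); first by exists (Imp Bot Bot) => x; split=> // _ [].
  by exists Bot.
have [m /andP[_ mN] [[c dc sc] nm]] :=
  @last_before (fun m => definable_onto V (ordinal m)) N P1 nV.
have cE Q x y : definable V Q -> c x = c y -> Q x -> Q y.
  move=> dQ xy Qx; apply: contrapT => nQy; apply: nm.
  (* The part of the piece of [x] inside [Q] gets the new colour [ord_max]; all other points keep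
     theirs. *)
  pose c' w := let: (i, b) := (c w, `[< Q w >]) in
    if b && (i == c x) then ord_max else widen_ord (leqnSn m) i.
  exists c'.
    exact: (definable_map_comp
      (fun p => if p.2 && (p.1 == c x) then ord_max else widen_ord (leqnSn m) p.1)
      (definable_map_pair dc (definable_map_bool dQ))).
  move=> t; case: (unliftP ord_max t) => [i ->|->]; last first.
    by exists x; rewrite /c' eqxx andbT; case: asboolP.
  have -> : lift ord_max i = widen_ord (leqnSn m) i.
    by apply: val_inj; rewrite /= /bump leqNgt ltn_ord.
  have [->|ne] := eqVneq i (c x).
    by exists y; rewrite /c' -xy; case: asboolP.
  by have [z cz] := sc i; exists z; rewrite /c' cz (negbTE ne) andbF.
pose r i j := exists x y, [/\ c x = i, c y = j & acc x y].
have bc : @bounded_morphism F (Frame r) c.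
  split=> [x y xy|x u|x u]; first by exists x, y.
  - move=> [x' [y [xx' <- xy]]].
    (* Seeing a given piece is definable, so it passes from [x'] to every point of the same
       piece. *)
    apply: (cE [set w | exists2 z, acc w z & c z = c y] x') => //.
      exact/definable_pred/(dc [set c y]).
    by exists y.
  - move=> [y [x' [<- xx' xy]]].
    apply: (cE [set w | exists2 z, acc z w & c z = c y] x') => //.
      exact/definable_succ/(dc [set c y]).
    by exists y.
exists m, r; split=> //.
  exact: definable_morphism_Log tL mL bc sc dc.
move=> a ra x.
apply/(@bounded_morphism_sat F (Frame r) c V
         (fun n i => exists2 z, c z = i & V n z) x a bc); last exact: ra.
move=> n y; split=> [Vy|[z zy Vz]]; first by exists y.
by apply: (cE (V n) z) => //; exists (Var n).
Qed.

(** The witness is the disjoint union of those members of the family that validate [L]; each summand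
    embeds by a bounded morphism. *)
Lemma tabular_finite_frames (L : set form) (J : finType) (n : J -> nat)
    (r : forall j, 'I_(n j) -> 'I_(n j) -> Prop) :
  (forall a, ~ L a -> exists2 j, L `<=` Log (Frame (@r j)) & ~ Log (Frame (@r j)) a) ->
  tabular L.
Proof.
move=> complete.
pose good j := `[< L `<=` Log (Frame (@r j)) >].
pose T : finType := {j : {j : J | good j} & 'I_(n (sval j))}.
pose R (u v : T) := exists j (x y : 'I_(n (sval j))),
  [/\ u = existT _ j x, v = existT _ j y & @r (sval j) x y].
pose inj (j : {j | good j}) (x : 'I_(n (sval j))) : T := existT _ j x.
have inj_bm (j : {j | good j}) :
    @bounded_morphism (Frame (@r (sval j))) (Frame R) (@inj j).
  split.
  - by move=> x y xy; exists j, x, y.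
  - move=> x _ [i [x' [y [e -> xy]]]].
    have ij : i = j by have := congr1 (fun u : T => tag u) e.
    subst i; exists y => //.
    have -> // : x = x'.
    exact: eq_from_Tagged e.
  - move=> x _ [i [y [x' [-> e xy]]]].
    have ij : i = j by have := congr1 (fun u : T => tag u) e.
    subst i; exists y => //.
    have -> // : x = x'.
    exact: eq_from_Tagged e.
exists (Frame R); first exact: (@finite_finset T).
apply/seteqP; split=> [a La V [j x]|a Ra].
  have Lj : L `<=` Log (Frame (@r (sval j))) by apply/asboolP/(valP j).
  have := Lj _ La (fun k y => V k (inj j y)) x.
  by move/(bounded_morphism_sat _ _ (inj_bm j)); apply.
apply: contrapT => /complete[j /asboolP gj]; apply=> U x.
pose j' : {j | good j} := exist _ j gj.
pose V k (u : T) := exists x : 'I_(n j), u = inj j' x /\ U k x.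
have := Ra V (inj j' x).
move/(bounded_morphism_sat _ _ (inj_bm j')); apply => k y; split.
  by move=> Uy; exists y.
move=> [y' [e]]; have -> // : y = y'.
exact: eq_from_Tagged e.
Qed.

(** Coding relations as finite sets of pairs makes the frames on ['I_m] with [m <= N] a finite
    family, which contains all the quotients needed. *)
Lemma bounded_tabular (L : set form) N : tense_logic L -> S43t `<=` L ->
  (forall (F : frame) (V : nat -> set F), linear_preorder F -> models V L ->
     ~ definable_onto V 'I_N.+1) ->
  tabular L.
Proof.
move=> tL SL bL.
apply: (@tabular_finite_frames L {m : 'I_N.+1 & {set 'I_m * 'I_m}}
  (fun j => tag j) (fun j x y => (x, y) \in tagged j)) => a nLa.
have [F [V [lF mV [x nxa]]]] := linear_model tL SL nLa.
have [m [r [mN Lr ra]]] := finite_quotient x tL mV (bL F V lF mV).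
pose j : {m : 'I_N.+1 & {set 'I_m * 'I_m}} :=
  existT _ (Ordinal (mN : m < N.+1)) (finset (fun p => `[< r p.1 p.2 >])).
have E : (fun x y => (x, y) \in tagged j) = r :> ('I_m -> 'I_m -> Prop).
  by apply/funext => y; apply/funext => z; rewrite finset.inE /= asboolE.
exists j; first by rewrite E.
by rewrite E => /ra.
Qed.

(* The layer [0] is the top one, in accordance with [chain]. *)
Definition layering (F : frame) (V : nat -> set F) m (h : F -> 'I_m) :=
  [/\ definable_map V h, forall i, exists x, h x = i &
      forall x y, acc x y -> h y <= h x].

(** The four cluster shapes at once. As index 0 is the top, [lo] adds a point seen by the cluster
    and [hi] a point seeing it. *)
Definition cluster_frame (lo hi : bool) (I : Type) : frame :=
  @blowup (chain (lo + hi).+1) (@Ordinal (lo + hi).+1 lo (leq_addr hi lo)) I.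

(** * Layerings of a linear model and their collapse to chains and clusters *)

Section Layers.
Variables (F : frame) (V : nat -> set F) (L : set form).
Hypotheses (lF : linear_preorder F) (tL : tense_logic L) (mV : models V L).

Lemma layering_lt m (h : F -> 'I_m) x y : layering V h -> h y < h x -> acc x y.
Proof.
move=> [_ _ ah]; have [_ _ tF] := lF.
by have [//|/ah] := tF x y; rewrite leqNgt => /negP.
Qed.

Lemma layering_chain m (h : F -> 'I_m) : layering V h -> L `<=` Log (chain m).
Proof.
move=> lh; have [dh sh ah] := lh; have [rF _ _] := lF.
apply: (@definable_morphism_Log F V (chain m) h) => //; split=> [//|x u|x u].
- rewrite /= leq_eqVlt => /orP[/eqP/val_inj ->|ux]; first by exists x.
  by have [y yu] := sh u; exists y => //; apply: layering_lt lh _; rewrite yu.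
- rewrite /= leq_eqVlt => /orP[/eqP/val_inj <-|ux]; first by exists x.
  by have [y yu] := sh u; exists y => //; apply: layering_lt lh _; rewrite yu.
Qed.

(** Layer [i] is mapped by colour onto the cluster, [None] going to the original point, and every
    other layer to one point. The density hypothesis gives the back conditions inside layer [i];
    between layers, linearity does. *)
Lemma layering_blowup m (h : F -> 'I_m) (i : 'I_m) k (col : F -> option 'I_k) :
  layering V h -> definable_map V col ->
  (forall x t, h x = i -> (exists y, [/\ acc x y, h y = i & col y = t]) /\
                          (exists y, [/\ acc y x, h y = i & col y = t])) ->
  L `<=` Log (@blowup (chain m) i 'I_k).
Proof.
move=> lh dcol dense; have [dh sh ah] := lh; have [rF _ _] := lF.
pose q (p : 'I_m * option 'I_k) : 'I_m + 'I_k :=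
  if p.1 == i then if p.2 is Some t then inr t else inl i else inl p.1.
pose orig (u : 'I_m + 'I_k) := if u is inl j then j else i.
pose g w := q (h w, col w).
have origE w : orig (g w) = h w.
  by rewrite /g /q /=; case: eqP => //= ->; case: (col w).
have gE u : orig u = i -> exists t, forall y, h y = i -> col y = t -> g y = u.
  case: u => [j /= ->|t _]; [exists None|exists (Some t)] => y yi yt;
  by rewrite /g /q /= yi yt eqxx.
have gN x u : h x <> i -> orig u = h x -> g x = u.
  move=> xi; case: u => [j|t] /= E; last by case: xi.
  by rewrite /g /q /= E ifN //; apply/eqP.
have sg u : exists x, g x = u.
  have [x xu] := sh (orig u); have [xi|/eqP xi] := eqVneq (h x) i.
    have [|t gt] := gE u; first by rewrite -xu.
    by have [[y [_ yi yt]] _] := dense x t xi; exists y; apply: gt.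
  by exists x; apply: gN.
apply: (@definable_morphism_Log F V (@blowup (chain m) i 'I_k) g) => //.
- split=> [x y xy|x u xu|x u xu].
  + by have := ah _ _ xy; rewrite -!origE.
  + have : orig u <= h x by rewrite -origE.
    rewrite leq_eqVlt => /orP[/eqP/val_inj ux|ux]; last first.
      by have [y yu] := sg u; exists y => //;
        apply: layering_lt lh _; rewrite -origE yu.
    have [xi|/eqP xi] := eqVneq (h x) i; last by exists x => //; apply: gN.
    have [|t gt] := gE u; first by rewrite ux.
    by have [[y [xy yi yt]] _] := dense x t xi; exists y => //; apply: gt.
  + have : h x <= orig u by rewrite -origE.
    rewrite leq_eqVlt => /orP[/eqP/val_inj ux|ux]; last first.
      by have [y yu] := sg u; exists y => //;
        apply: layering_lt lh _; rewrite -[h y]origE yu.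
    have [xi|/eqP xi] := eqVneq (h x) i; last by exists x => //; apply: gN.
    have [|t gt] := gE u; first by rewrite -ux.
    by have [_ [y [xy yi yt]]] := dense x t xi; exists y => //; apply: gt.
- exact: definable_map_comp (definable_map_pair dh dcol).
Qed.

(** If [P] separated two points of a layer, raising the index of all points of [P] by one would give
    one more layer: by linearity, layers of larger index lie inside [P] and those of smaller index
    outside. *)
Lemma layering_maximal m (h : F -> 'I_m) (P : set F) x y :
  layering V h -> (forall h' : F -> 'I_m.+1, ~ layering V h') ->
  definable V P -> (forall z w, acc z w -> P w -> P z) ->
  h x = h y -> P x -> P y.
Proof.
move=> lh maxh dP Pdown xy Px; apply: contrapT => nPy; have [dh sh ah] := lh.
have Plt w : h x < h w -> P w by move=> /(layering_lt lh) /Pdown; apply.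
have Pgt w : P w -> h x <= h w.
  by move=> Pw; rewrite leqNgt xy; apply/negP => /(layering_lt lh) /Pdown /(_ Pw).
pose q (p : 'I_m * bool) : 'I_m.+1 := inord (p.1 + p.2).
have qE p : q p = p.1 + p.2 :> nat.
  by rewrite inordK //; case: p => i [] /=; rewrite ?addn1 ?addn0 ltnS // ltnW.
apply: (maxh (fun w => q (h w, `[< P w >]))); split.
- exact: definable_map_comp (definable_map_pair dh (definable_map_bool dP)).
- move=> t; have [tx|xt|tx] := ltngtP t (h x).
  + have [w wt] := sh (Ordinal (ltn_trans tx (ltn_ord (h x)))).
    exists w; apply: val_inj; rewrite /= qE /= wt /=.
    case: asboolP => [/Pgt|]; last by rewrite addn0.
    by rewrite wt leqNgt tx.
  + have t0 : 0 < t by apply: leq_ltn_trans xt.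
    have [tx|tx] := eqVneq t.-1 (h x :> nat).
      exists x; apply: val_inj; rewrite /= qE /= -tx.
      by case: asboolP => // _; rewrite addn1 prednK.
    have tm : t.-1 < m by rewrite -ltnS prednK.
    have [w wt] := sh (Ordinal tm).
    exists w; apply: val_inj; rewrite /= qE /= wt /=.
    case: asboolP => [_|[]]; first by rewrite addn1 prednK.
    by apply: Plt; rewrite wt /= ltn_neqAle eq_sym tx -ltnS prednK.
  + exists y; apply: val_inj; rewrite /= qE /= -xy tx.
    by case: asboolP => // _; rewrite addn0.
- move=> z w zw; rewrite !qE /= leq_add ?ah //.
  by case: asboolP => // /(Pdown _ _ zw) Pz; case: asboolP.
Qed.

(** Maximality is applied to two sets closed under predecessors: the points seeing some point of
    [Q], and the points seen by none. By reflexivity [z] is in the first and not in the second,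
    which settles [x]. *)
Lemma layering_dense m (h : F -> 'I_m) (P : set F) x z :
  layering V h -> (forall h' : F -> 'I_m.+1, ~ layering V h') ->
  definable V P -> P z -> h x = h z ->
  (exists y, [/\ acc x y, h y = h z & P y]) /\
  (exists y, [/\ acc y x, h y = h z & P y]).
Proof.
move=> lh maxh dP Pz xz; have [rF tF _] := lF; have [dh _ _] := lh.
pose Q := h @^-1` [set h z] `&` P.
have dQ : definable V Q by apply: definableI.
split.
  have [|||y xy [yz Py]] :=
    layering_maximal (x := z) (y := x) lh maxh (definable_pred dQ).
  - by move=> u v uv [y vy Qy]; exists y => //; apply: tF uv vy.
  - by [].
  - by exists z.
  by exists y.
apply: contrapT => nx.
suff : (~` [set w | exists2 y, acc y w & Q y]) z by apply; exists z.
apply: (layering_maximal (x := x) lh maxh (definableC (definable_succ dQ))).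
- move=> u v uv nv [y yu Qy]; apply: nv; exists y => //; exact: tF yu uv.
- by [].
- by move=> [y yx [yz Py]]; apply: nx; exists y.
Qed.

(** Pigeonhole: among representatives of the [(m * k).+1] colours, more than [k] share a layer. *)
Lemma crowded_layer m k (h : F -> 'I_m) : layering V h ->
  definable_onto V 'I_(m * k).+1 ->
  exists (i : 'I_m) (col : F -> option 'I_k),
    definable_map V col /\ forall t, exists2 x, h x = i & col x = t.
Proof.
move=> lh [c dc sc]; have [s cs] := choice sc.
have [i ki] : exists i, k < #|[pred j | h (s j) == i]|.
  apply: contrapT => /forallNP small.
  have : #|'I_(m * k).+1| <= m * k.
    rewrite -sum1_card (partition_big (fun j => h (s j)) predT) //=.
    rewrite -[X in _ <= X * _]card_ord -sum_nat_const leq_sum // => i _.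
    by rewrite sum1_card leqNgt; apply/negP/small.
  by rewrite card_ord ltnn.
set A := [pred j | h (s j) == i] in ki.
(* The first [k] colours of the list are kept; all others are merged into [None]. *)
pose d j : option 'I_k := insub (index j (enum A)).
exists i, (d \o c); split; first exact: definable_map_comp.
(* Position [k] is the first one sent to [None]; it exists because the list has more than [k]
   entries. *)
move=> t; pose n : nat := if t is Some j then j else k.
have nA : n < size (enum A).
  by rewrite -cardE; apply: leq_ltn_trans ki; rewrite /n; case: (t) => // j;
    apply: ltnW.
have [j0 _] : exists j : 'I_(m * k).+1, True by exists ord0.
pose j := nth j0 (enum A) n.
have : j \in A by rewrite -mem_enum mem_nth.
move=> /eqP ji; exists (s j) => //=.
rewrite cs /d index_uniq ?enum_uniq //.
rewrite /n; case: (t) => [t'|]; first by rewrite valK.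
by rewrite insubF // ltnn.
Qed.

Lemma crowded_cluster m k (h : F -> 'I_m) : layering V h ->
  (forall h' : F -> 'I_m.+1, ~ layering V h') ->
  definable_onto V 'I_(m * k).+1 ->
  exists lo hi, L `<=` Log (cluster_frame lo hi 'I_k).
Proof.
move=> lh maxh /(crowded_layer lh)[i [col [dcol coli]]].
exists (0 < i), (i < m.-1).
have [dh sh ah] := lh.
have im (j : 'I_m) : j <= m.-1 by rewrite -ltnS prednK // (leq_ltn_trans _ (ltn_ord j)).
have m0 : m.-1 < m by rewrite prednK // (leq_ltn_trans _ (ltn_ord i)).
(* All layers of smaller index than [i] are merged into 0, and all of larger index into the last
   one; either group may be absent. *)
pose q (j : 'I_m) : 'I_((0 < i) + (i < m.-1)).+1 :=
  inord (if i <= j then (0 < i) + (i < j) else 0).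
have qE j : q j = (if i <= j then (0 < i) + (i < j) else 0) :> nat.
  rewrite inordK // ltnS; case: ifP => // _; rewrite leq_add2l.
  by case: ltnP => // /leq_trans -> //.
have qi j : q j = (0 < i) :> nat -> j = i.
  rewrite qE; case: (ltngtP i j) => [ij|ji|ij _]; last exact: val_inj.
    by rewrite addn1 => /eqP; rewrite eqn_leq ltnn.
  by rewrite (leq_ltn_trans _ ji).
have qii : q i =
    @Ordinal ((0 < i) + (i < m.-1)).+1 (0 < i) (leq_addr (i < m.-1) (0 < i)).
  by apply: val_inj; rewrite /= qE leqnn ltnn addn0.
have sq t : exists j, q j = t.
  have [ti|it|ti] := ltngtP t (0 < i); last by exists i; rewrite qii; apply: val_inj.
    exists (Ordinal (leq_ltn_trans (leq0n _) m0)).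
    have i0 : 0 < i by have := leq_ltn_trans (leq0n _) ti; rewrite lt0b.
    have t0 : t = 0 :> nat by apply/eqP; rewrite -leqn0 -ltnS (leq_trans ti) ?leq_b1.
    by apply: val_inj; rewrite /= qE /= t0 leqNgt i0.
  have [im1 tE] : i < m.-1 /\ t = (0 < i) + 1 :> nat.
    have := ltn_ord t; rewrite ltnS => tle; have := leq_trans it tle.
    rewrite -addn1 leq_add2l lt0b => im1; split=> //.
    have t1 := leq_trans tle (leq_add (leqnn _) (leq_b1 _)).
    by apply/eqP; rewrite eqn_leq t1 addn1.
  exists (Ordinal m0); apply: val_inj; rewrite /= qE /= tE.
  by rewrite im1 im.
apply: (@layering_blowup _ (q \o h) _ k col) => //.
- split; first exact: definable_map_comp.
  + by move=> t; have [j <-] := sq t; have [x <-] := sh j; exists x.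
  + move=> x y /ah xy /=; rewrite !qE; case: (leqP i (h y)) => // iy.
    rewrite (leq_trans iy xy) leq_add2l.
    by case: (ltnP i (h y)) => // /leq_trans ->.
- move=> x t /= xi.
  have {}xi : h x = i by apply: qi; rewrite xi.
  have [z zi zt] := coli t.
  have [|[y [xy yi yt]] [y' [yx yi' yt']]] :=
    layering_dense (x := x) (z := z) lh maxh (dcol [set t]) zt.
    by rewrite xi.
  by split; [exists y|exists y']; rewrite ?yi ?yi' zi qii.
Qed.

End Layers.

(** * Containment of nontabular logics in one of the five *)

Lemma definable_onto_leq (F : frame) (V : nat -> set F) m n : m <= n ->
  definable_onto V 'I_n.+1 -> definable_onto V 'I_m.+1.
Proof.
move=> mn [c dc sc]; exists ((fun i : 'I_n.+1 => inord (minn i m)) \o c).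
  exact: definable_map_comp.
move=> i; have im : i <= m by rewrite -ltnS.
have [x xi] := sc (inord i); exists x => /=; apply: val_inj.
by rewrite xi /= !inordK ?ltnS ?geq_minr ?(leq_trans im) // (minn_idPl im).
Qed.

(** Without a layering in [n.+1] layers, a maximal one has [m <= n] layers, and [(n * k).+1] pieces
    are enough to crowd one of them. *)
Lemma chain_or_cluster (F : frame) (V : nat -> set F) (L : set form) n k :
  linear_preorder F -> tense_logic L -> models V L ->
  definable_onto V 'I_(n * k).+1 ->
  L `<=` Log (chain n.+1) \/ exists lo hi, L `<=` Log (cluster_frame lo hi 'I_k).
Proof.
move=> lF tL mV cV; have [[h lh]|nh] := EM (exists h : F -> 'I_n.+1, layering V h).
  by left; apply: layering_chain lh.
have h1 : exists h : F -> 'I_1, layering V h.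
  have [c dc sc] := definable_onto_leq (leq0n _) cV.
  by exists c; split=> // x y _; rewrite [c x]ord1 [c y]ord1.
right; have [m /andP[_ mn] [[h lh] maxh]] :=
  @last_before (fun m => exists h : F -> 'I_m, layering V h) n h1 nh.
apply: (crowded_cluster lF tL mV lh); first by move=> h' lh'; apply: maxh; exists h'.
by apply: definable_onto_leq cV; rewrite leq_mul2r mn orbT.
Qed.

Lemma occurs_bound a : exists M, forall n, occurs n a -> n < M.
Proof.
elim: a => [m||b [M HM] c [N HN]|//|//].
- by exists m.+1 => n ->.
- by exists 0.
- exists (maxn M N) => n [/HM|/HN] nb; rewrite leq_max nb ?orbT //.
Qed.

(** A formula in [M] variables distinguishes at most [2 ^ M] points of the cluster, so a refutation
    survives when the cluster keeps one representative of each kind. *)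
Lemma blowup_limit (F : frame) (x : F) a : ~ Log (@blowup F x nat) a ->
  exists K, forall k, K <= k -> ~ Log (@blowup F x 'I_k) a.
Proof.
move=> /existsNP[V /existsNP[u nua]]; have [M occM] := occurs_bound a.
exists #|{ffun 'I_M -> bool}|.+1 => k Kk Lk.
pose pr j : {ffun 'I_M -> bool} := [ffun n : 'I_M => `[< V n (inr j) >]].
(* Index [i] represents the [i]-th truth assignment; unrealised assignments and surplus indices
   receive arbitrary points. *)
have [e eP] : exists e : 'I_k -> nat, forall j, exists i, pr (e i) = pr j.
  have [p pP] : {p : {ffun 'I_M -> bool} -> nat & forall f,
      (exists j, pr j = f) -> pr (p f) = f}.
    apply: (@choice _ _ (fun f j => (exists j, pr j = f) -> pr j = f)) => f.
    by have [[j jf]|nj] := EM (exists j, pr j = f); [exists j|exists 0].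
  have [f0 _] : exists f : {ffun 'I_M -> bool}, True by exists [ffun=> true].
  exists (fun i => p (nth f0 (enum {ffun 'I_M -> bool}) i)) => j.
  have jk : index (pr j) (enum {ffun 'I_M -> bool}) < k.
    by apply: leq_ltn_trans Kk; rewrite cardE index_size.
  exists (Ordinal jk) => /=.
  by rewrite nth_index ?mem_enum // pP //; exists j.
have {}eP j : exists i, forall n, n < M -> (V n (inr j) <-> V n (inr (e i))).
  have [i /ffunP ij] := eP j; exists i => n nM.
  have := ij (Ordinal nM); rewrite !ffunE /= => E.
  by rewrite -[V n (inr j)]asboolE -E asboolE.
pose E (v : blowup x 'I_k) : blowup x nat :=
  match v with inl y => inl y | inr i => inr (e i) end.
pose orig I (v : F + I) := if v is inl y then y else x.
(* Accessibility depends only on the original point, so the back and forth conditions need only that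
   each point is related to some point on the other side. *)
pose Z (w : blowup x nat) (v : blowup x 'I_k) :=
  orig nat w = orig 'I_k v /\ forall n, n < M -> (V n w <-> V n (E v)).
have origE v : orig nat (E v) = orig 'I_k v by case: v.
have Zf w : exists v, Z w v.
  case: w => [y|j]; first by exists (inl y).
  by have [i ij] := eP j; exists (inr i).
have Zb v : Z (E v) v by split.
have [v uv] := Zf u.
suff uvE : sat V u a <-> sat (fun n v => V n (E v)) v a by apply/nua/uvE/Lk.
apply: (@bisimulation _ _ V (fun n v => V n (E v)) Z a) => //.
- by move=> w v' n [_ wv] /occM /wv.
- move=> w v' w' [wv _] ww'; have [v'' w'v''] := Zf w'; exists v'' => //.
  by case: w'v'' => w'v'' _; rewrite /= -/(orig _ _) -/(orig _ _) -wv -w'v''.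
- move=> w v' w' [wv _] ww'; exists (E w') => //.
  by rewrite /= -/(orig _ _) -/(orig _ _) origE wv.
- move=> w v' w' [wv _] ww'; have [v'' w'v''] := Zf w'; exists v'' => //.
  by case: w'v'' => w'v'' _; rewrite /= -/(orig _ _) -/(orig _ _) -wv -w'v''.
- move=> w v' w' [wv _] ww'; exists (E w') => //.
  by rewrite /= -/(orig _ _) -/(orig _ _) origE wv.
Qed.

Definition five (t : option (bool * bool)) : set form :=
  if t is Some (lo, hi) then Log (cluster_frame lo hi nat) else L_up.

(** Otherwise [L] excludes some chain and all large clusters of each shape, which bounds the
    definable partitions of its linear models and makes [L] tabular. *)
Lemma nontabular_sub_five (L : set form) : tense_logic L -> S43t `<=` L ->
  ~ tabular L -> exists t, L `<=` five t.
Proof.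
move=> tL SL nL; apply: contrapT => /forallNP nsub.
have [n nLn] : exists n, ~ L `<=` Log (chain n.+1).
  have /existsNP[a /not_implyP[La /existsNP[n /not_implyP[n1 na]]]] := nsub None.
  by exists n.-1; rewrite prednK // => /(_ a La).
have [K KP] : {K : bool * bool -> nat & forall p k, K p <= k ->
    ~ L `<=` Log (cluster_frame p.1 p.2 'I_k)}.
  apply: (@choice _ _ (fun p K => forall k, K <= k ->
    ~ L `<=` Log (cluster_frame p.1 p.2 'I_k))) => -[lo hi].
  have /existsNP[a /not_implyP[La na]] := nsub (Some (lo, hi)).
  have [K KP] := blowup_limit na.
  by exists K => k /KP nka /(_ a La).
(* One cluster size beyond the thresholds of all four shapes. *)
pose k := \max_p K p.
apply: nL; apply: (@bounded_tabular L (n * k)) => // F V lF mV cV.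
have [//|[lo [hi]]] := chain_or_cluster lF tL mV cV.
by apply: (KP (lo, hi)); apply: leq_bigmax.
Qed.

Lemma chain_linear n : linear_preorder (chain n).
Proof.
split=> [x|x y z xy yz|x y] /=; first exact: leqnn.
  exact: leq_trans yz xy.
by apply/orP; apply: leq_total.
Qed.

Lemma blowup_linear (F : frame) (x : F) I :
  linear_preorder F -> linear_preorder (@blowup F x I).
Proof.
by move=> [rF tF lF]; split=> [u|u v w|u v] /=; [apply: rF|apply: tF|apply: lF].
Qed.

Lemma five_tense t : tense_logic (five t).
Proof.
case: t => [[lo hi]|]; first exact: Log_tense.
by apply: bigcap_tense => n; apply: Log_tense.
Qed.

Lemma five_S43t t : S43t `<=` five t.
Proof.
case: t => [[lo hi]|] a Sa; first exact/Sa/blowup_linear/chain_linear.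
by move=> n _; apply/Sa/chain_linear.
Qed.

(** * Separating formulas: cardinality, depth, Grzegorczyk and McKinsey *)

Fixpoint bigAnd (f : nat -> form) n : form :=
  if n is m.+1 then And (bigAnd f m) (f m) else Imp Bot Bot.

Lemma sat_bigAnd (F : frame) (V : nat -> set F) x f n :
  sat V x (bigAnd f n) <-> forall i, i < n -> sat V x (f i).
Proof.
elim: n => [|n IHn]; first by split=> [_ i|_ []].
rewrite [bigAnd f n.+1]/= (propext (sat_And _ _ _ _)) (propext IHn).
split=> [[h hn] i|h]; first by rewrite ltnS leq_eqVlt => /predU1P[->//|/h].
by split=> [i ni|]; apply: h => //; apply: leqW.
Qed.

(* Valid on a frame iff no point sees [n] pairwise distinct points. *)
Definition few_points n : form :=
  Neg (bigAnd (fun i => Dia (And (Var i) (bigAnd (fun j => Neg (Var j)) i))) n).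

Lemma finite_few_points (F : frame) n : [set: F] #= `I_n -> Log F (few_points n.+1).
Proof.
move=> cF V x; apply/sat_Neg => /sat_bigAnd few.
have [y yP] : {y : nat -> F & forall i, i < n.+1 -> V i (y i) /\
    forall j, j < i -> ~ V j (y i)}.
  apply: (@choice _ _ (fun i y => i < n.+1 -> V i y /\ forall j, j < i -> ~ V j y)) => i.
  have [/few/sat_Dia[y _ /sat_And[iy /sat_bigAnd jy]]|ni] := EM (i < n.+1).
    by exists y => _; split=> // j /jy.
  by exists x.
have /card_set_bijP[f [fF injf _]] := cF.
suff : n.+1 <= n by rewrite ltnn.
apply: (@pigeonhole _ _ (f \o y)) => [i j|_ [i _ <-]]; last exact: fF.
rewrite !in_setE /= => ni nj /injf; rewrite !in_setE => /(_ I I) yij.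
have [ij|ji|//] := ltngtP i j.
- by have [_ /(_ _ ij)] := yP _ nj; rewrite -yij; have [] := yP _ ni.
- by have [_ /(_ _ ji)] := yP _ ni; rewrite yij; have [] := yP _ nj.
Qed.

Lemma many_points (F : frame) n x (y : nat -> F) :
  (forall i, i < n -> acc x (y i)) ->
  (forall i j, i < n -> j < n -> y i = y j -> i = j) -> ~ Log F (few_points n).
Proof.
move=> xy injy /(_ (fun i => [set y i]) x)/sat_Neg; apply.
apply/sat_bigAnd => i ni; apply/sat_Dia; exists (y i); first exact: xy.
apply/sat_And; split=> //; apply/sat_bigAnd => j ji; apply/sat_Neg.
by move=> /(injy _ _ ni (ltn_trans ji ni)) ij; rewrite ij ltnn in ji.
Qed.

(** A frame with [n] points validates [few_points n.+1], which fails at a point of an infinite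
    cluster and at the root of [chain n.+1]. *)
Lemma five_nontabular t : ~ tabular (five t).
Proof.
move=> [F [n cF] tF]; have := finite_few_points cF; rewrite -tF.
case: t {tF} => [[lo hi]|].
  apply: (@many_points (cluster_frame lo hi nat) _ (inr 0) inr) => [i _|i j _ _ []//].
  exact: leqnn.
move=> /(_ n.+1 isT); apply: (@many_points (chain n.+1) _ ord_max inord).
  by move=> i ni; apply: leq_ord.
by move=> i j ni nj /(congr1 val); rewrite /= !inordK.
Qed.

(** Forces [n] strict steps: the next point satisfies [Box (Neg (Var m.+1))], hence cannot see back.
    On preorders its negation bounds the depth by [n]. *)
Fixpoint descent n : form :=
  if n is m.+1
  then And (Var m.+1) (Dia (And (Box (Neg (Var m.+1))) (descent m)))
  else Var 0.

Lemma descent_sound (F : frame) (rk : F -> nat) V x n :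
  (forall y z, acc y z -> ~ acc z y -> rk z < rk y) -> sat V x (descent n) ->
  n <= rk x.
Proof.
move=> rkP; elim: n x => [//|n IHn] x /sat_And[xn /sat_Dia[y xy]].
move=> /sat_And[yn /IHn ny]; apply: leq_ltn_trans ny _; apply: rkP => // yx.
exact: yn yx xn.
Qed.

Lemma descent_complete (F : frame) (f : nat -> F) n :
  (forall i j, i <= n -> j <= n -> acc (f i) (f j) <-> j <= i) ->
  ~ Log F (Neg (descent n)).
Proof.
move=> fP /(_ (fun i => [set f i]) (f n))/sat_Neg; apply.
elim: n fP => [//|n IHn] fP; apply/sat_And; split=> //.
apply/sat_Dia; exists (f n); first by apply/fP.
apply/sat_And; split.
  by move=> _ /[swap] ->; rewrite (propext (fP _ _ _ _)) // ltnn.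
by apply: IHn => i j ni nj; apply: fP; apply: leqW.
Qed.

Lemma blowup_chain_descent n (x : chain n) I :
  Log (@blowup (chain n) x I) (Neg (descent n)).
Proof.
pose rk (u : blowup x I) := if u is inl y then val y else val x.
move=> V u; apply/sat_Neg => /(@descent_sound _ rk) nu.
have : rk u < n by rewrite /rk; case: (u) => *; apply: ltn_ord.
rewrite ltnNge nu // => v w _ /negP; rewrite -ltnNge.
by case: v => ?; case: w => ?.
Qed.

Lemma chain_descent n : ~ Log (chain n.+1) (Neg (descent n)).
Proof.
apply: (@descent_complete (chain n.+1) inord) => i j ni nj.
by rewrite /= !inordK.
Qed.

Lemma blowup_chain_not_descent m n (x : chain n) I : m < n ->
  ~ Log (@blowup (chain n) x I) (Neg (descent m)).
Proof.
case: n x => // n x mn.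
apply: (@descent_complete (@blowup (chain n.+1) x I) (fun i => inl (inord i))).
by move=> i j im jm; rewrite /= !inordK // ltnS ?(leq_trans im) ?(leq_trans jm).
Qed.

Definition grz : form :=
  Imp (Box (Imp (Box (Imp (Var 0) (Box (Var 0)))) (Var 0))) (Var 0).

Lemma chain_grz n : Log (chain n) grz.
Proof.
move=> V x /= xgrz.
(* Induction from the top: once all points strictly above [y] satisfy [Var 0], antisymmetry gives
   the premise of [xgrz] at [y]. *)
suff H k (y : 'I_n) : y < k -> y <= x -> V 0 y by apply: (H x.+1).
elim: k y => [//|k IHk] y yk yx; apply: xgrz => // z zy z0 w wz.
have [wy|yw] := ltnP w y.
  by apply: IHk; [apply: leq_trans wy yk|apply: leq_trans wz (leq_trans zy yx)].
have -> // : w = z.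
by apply: val_inj; apply/eqP; rewrite eqn_leq wz (leq_trans zy yw).
Qed.

(** [Var 0] fails at just one point of the cluster, so another cluster point satisfies [Var 0]
    without [Box (Var 0)]. *)
Lemma cluster_not_grz lo hi : ~ Log (cluster_frame lo hi nat) grz.
Proof.
move=> /(_ (fun _ => ~` [set inr 0]) (inr 0)); apply=> //= y _ yc yE.
rewrite yE in yc; apply: (yc (inr 1) _ _ (inr 0)) => //=; exact: leqnn.
Qed.

Definition mckinsey_future : form := Imp (Box (Dia (Var 0))) (Dia (Box (Var 0))).
Definition mckinsey_past : form := Imp (PBox (PDia (Var 0))) (PDia (PBox (Var 0))).

Lemma top_mckinsey_future (F : frame) (t : F) :
  (forall x, acc x t) -> (forall y, acc t y -> y = t) -> Log F mckinsey_future.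
Proof.
move=> xt tE V x; apply/sat_Imp => h; have : sat V t (Dia (Var 0)) by apply: h.
move=> /sat_Dia[y /tE -> Vt].
by apply/sat_Dia; exists t => //; apply/sat_Box => z /tE ->.
Qed.

Lemma top_not_mckinsey_future (F : frame) (s t : F) :
  (forall x, acc x s) -> (forall x, acc x t) -> s <> t ->
  ~ Log F mckinsey_future.
Proof.
move=> xs xt st; pose V := fun _ : nat => [set s].
move=> /(_ V s)/sat_Imp sts.
have /sts/sat_Dia[y _ ys] : sat V s (Box (Dia (Var 0))).
  by apply/sat_Box => y _; apply/sat_Dia; exists s.
exact/st/esym/(ys t).
Qed.

Lemma bottom_mckinsey_past (F : frame) (t : F) :
  (forall x, acc t x) -> (forall y, acc y t -> y = t) -> Log F mckinsey_past.
Proof.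
move=> xt tE V x; apply/sat_Imp => /sat_PBox /(_ t (xt x)) [y /tE -> Vt].
by apply/sat_PDia; exists t => //; apply/sat_PBox => z /tE ->.
Qed.

Lemma bottom_not_mckinsey_past (F : frame) (s t : F) :
  (forall x, acc s x) -> (forall x, acc t x) -> s <> t ->
  ~ Log F mckinsey_past.
Proof.
move=> xs xt st; pose V := fun _ : nat => [set s].
move=> /(_ V s)/sat_Imp sts.
have /sts/sat_PDia[y _ /sat_PBox ys] : sat V s (PBox (PDia (Var 0))).
  by apply/sat_PBox => y _; exists s.
exact/st/esym/(ys t).
Qed.

(** With [lo] there is a single final point [inl ord0]; without it the cluster itself is final and
    has distinct points. *)
Lemma cluster_mckinsey_future lo hi :
  Log (cluster_frame lo hi nat) mckinsey_future <-> lo.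
Proof.
split; case: lo => //.
  by case/(@top_not_mckinsey_future (cluster_frame false hi nat) (inr 0) (inr 1)).
move=> _.
apply: (@top_mckinsey_future (cluster_frame true hi nat) (inl ord0)).
  by case.
case=> // y; rewrite /= leqn0 => /eqP y0; congr inl; exact: val_inj.
Qed.

Lemma cluster_mckinsey_past lo hi :
  Log (cluster_frame lo hi nat) mckinsey_past <-> hi.
Proof.
split; case: hi => //.
  have low (j : nat) x : acc (inr j : cluster_frame lo false nat) x.
    by case: x => [x|k] /=; [rewrite (leq_trans (leq_ord x)) ?addn0|].
  by case/(bottom_not_mckinsey_past (low 0) (low 1)).
move=> _.
apply: (@bottom_mckinsey_past (cluster_frame lo true nat) (inl ord_max)).
  by case=> [x|k]; [apply: leq_ord|apply: leq_addr].
case=> [y|k] /= ty; last by rewrite addn1 ltnn in ty.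
by congr inl; apply: val_inj; apply/eqP; rewrite eqn_leq leq_ord.
Qed.

(** Between cluster logics, the McKinsey axioms give [lo -> lo'] and [hi -> hi'], and depth gives
    [lo' + hi' <= lo + hi], which forces equality. Depth and [grz] separate them from [L_up]. *)
Lemma five_antichain s t : five s `<=` five t -> s = t.
Proof.
have cut lo hi : Log (cluster_frame lo hi nat) (Neg (descent (lo + hi).+1)).
  exact: blowup_chain_descent.
case: s t => [[lo hi]|] [[lo' hi']|] // sub.
- have l : lo -> lo' by move=> /cluster_mckinsey_future /sub /cluster_mckinsey_future.
  have h : hi -> hi' by move=> /cluster_mckinsey_past /sub /cluster_mckinsey_past.
  have d : lo' + hi' <= lo + hi.
    rewrite leqNgt; apply/negP => lt.
    have := sub _ (cut lo hi); apply: blowup_chain_not_descent; exact: lt.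
  by case: lo lo' hi hi' l h d {sub} => [] [] [] [] l h d //;
    (by have := l isT) || (by have := h isT).
- by have /sub /(_ (lo + hi).+2 isT) /chain_descent := cut lo hi.
- by case: (@cluster_not_grz lo' hi'); apply: sub => n _; apply: chain_grz.
Qed.

(** A pretabular logic lies below some [five t], and equals it since [five t] is not tabular.
    Conversely, a nontabular proper extension of [five t] would lie below some [five s], against
    incomparability. *)
Lemma PTAB_five : PTAB S43t = range five.
Proof.
apply/seteqP; split=> [L [SL [tL nL maxL]]|_ [t _ <-]].
  have [t Lt] := nontabular_sub_five tL SL nL; exists t => //.
  apply/seteqP; split=> //; apply: contrapT => tL'.
  apply: (@five_nontabular t); apply: maxL => //; first exact: five_tense.
  move=> bot; apply: (@five_nontabular t).
  (* If inconsistent, [five t] would be the logic of the empty frame and so tabular. *)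
  exists (@Frame void (fun _ _ => False)); first exact: (@finite_finset void).
  apply/seteqP; split=> a _; first by move=> V [].
  apply: (tl_mp (five_tense t) _ bot).
  by apply: (tl_taut (five_tense t)).
split; first exact: five_S43t.
split; [exact: five_tense|exact: five_nontabular|].
move=> L tL [tsub nsub] _; apply: contrapT => /nontabular_sub_five[||s Ls] //.
  exact: subset_trans (@five_S43t t) tsub.
by apply: nsub; rewrite (five_antichain (subset_trans tsub Ls)).
Qed.

Theorem theorem6p10 :
  PTAB S43t = [set L_pm; L_plus; L_minus; L_circ; L_up] /\
  PTAB S43t #= `I_5.
Proof.
rewrite PTAB_five; split.
  (* The chain lengths agree by computation; only the bound proofs of the blown-up points differ. *)
  have pm : L_pm = five (Some (true, true)).
    by congr (Log (@blowup (chain 3) _ nat)); apply: val_inj.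
  have plus : L_plus = five (Some (true, false)).
    by congr (Log (@blowup (chain 2) _ nat)); apply: val_inj.
  have minus : L_minus = five (Some (false, true)).
    by congr (Log (@blowup (chain 2) _ nat)); apply: val_inj.
  have circ : L_circ = five (Some (false, false)).
    by congr (Log (@blowup (chain 1) _ nat)); apply: val_inj.
  have up : L_up = five None by [].
  rewrite pm plus minus circ up; apply/seteqP; split=> [_ [[[lo hi]|] _ <-]|L].
    by case: lo hi => [] []; rewrite /setU /=; tauto.
    by right.
  by move=> [[[[->|->]|->]|->]|->]; eexists.
apply: (card_eq_trans (inj_card_eq _)).
  by move=> s t _ _ st; apply: five_antichain; rewrite st.
apply/card_set_bijP; exists (fun t => val (enum_rank t)).
have c5 : #|{: option (bool * bool)}| = 5 by rewrite card_option card_prod card_bool.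
split.
- by move=> t _ /=; rewrite -c5.
- by move=> s t _ _ /val_inj /enum_rank_inj.
- move=> i; rewrite /= -c5 => i5.
  by exists (enum_val (Ordinal i5)) => //; rewrite enum_valK.
Qed.
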